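(* Let $n\ge4$. For any $n$-body co-circular central configuration, every exterior side has length less than $r_0$, and at each vertex there is at least one incident diagonal of length larger than $r_0$.
   Context: All masses are positive, and the bodies of a configuration occupy pairwise distinct positions. For bodies with masses $m_1,\dots,m_n$ at $\mathbf{q}_1,\dots,\mathbf{q}_n$ put $m=\sum_i m_i$, $c=\frac1m\sum_i m_i\mathbf{q}_i$, $U=\sum_{i<j}\frac{m_im_j}{|\mathbf{q}_i-\mathbf{q}_j|}$, $I=\sum_i m_i|\mathbf{q}_i-c|^2$. The configuration is central if $\nabla U+\frac{\lambda}{2}\nabla I=0$ with $\lambda=U/I$, i.e. $\sum_{j\ne i} m_im_j\frac{\mathbf{q}_j-\mathbf{q}_i}{|\mathbf{q}_j-\mathbf{q}_i|^3}=-\lambda m_i(\mathbf{q}_i-c)$ for all $i$. It is co-circular if its bodies lie on a common circle. Set $r_0=(m/\lambda)^{1/3}=(mI/U)^{1/3}$. Order the bodies counterclockwise along the circle as $(\mathbf{q}_1,\dots,\mathbf{q}_n)$. The edges are the segments $\overline{\mathbf{q}_i\mathbf{q}_j}$, $i\neq j$; an edge is an exterior side if $|i-j|=1$ or $|i-j|=n-1$, and a diagonal otherwise. An edge and a vertex $\mathbf{q}_i$ on that edge are called incident. *)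

(* Defs.v *)
From HB Require Import structures.
From mathcomp Require Import all_boot all_order all_algebra all_fingroup.
From mathcomp Require Import all_classical all_reals all_analysis.
Set Implicit Arguments.
Unset Strict Implicit.
Unset Printing Implicit Defensive.
Import Order.TTheory GRing.Theory Num.Theory.
Local Open Scope ring_scope.

(* The norm `|v| that the library puts on row vectors is the sup norm, so the
   Euclidean norm is defined here. *)
Definition eucl_norm (R : realType) (v : 'rV[R]_2) : R :=
  Num.sqrt (\sum_k v 0 k ^+ 2).

Definition eucl_dist (R : realType) (p q : 'rV[R]_2) : R := eucl_norm (p - q).

Definition unit_vec (R : realType) (t : R) : 'rV[R]_2 :=
  \row_k (if k == 0 then cos t else sin t).

Definition total_mass (R : realType) (n : nat) (m : 'I_n -> R) : R :=
  \sum_i m i.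

Definition center_of_mass (R : realType) (n : nat) (m : 'I_n -> R)
    (q : 'I_n -> 'rV[R]_2) : 'rV[R]_2 :=
  (total_mass m)^-1 *: \sum_i m i *: q i.

Definition potential (R : realType) (n : nat) (m : 'I_n -> R)
    (q : 'I_n -> 'rV[R]_2) : R :=
  \sum_(i < n) \sum_(j < n | (i < j)%N) m i * m j / eucl_dist (q i) (q j).

Definition inertia (R : realType) (n : nat) (m : 'I_n -> R)
    (q : 'I_n -> 'rV[R]_2) : R :=
  \sum_i m i * eucl_dist (q i) (center_of_mass m q) ^+ 2.

Definition multiplier (R : realType) (n : nat) (m : 'I_n -> R)
    (q : 'I_n -> 'rV[R]_2) : R :=
  potential m q / inertia m q.

(* The i-th equation is the q i component of
   grad U + (lambda / 2) grad I = 0, where lambda = U / I. *)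
Definition central (R : realType) (n : nat) (m : 'I_n -> R)
    (q : 'I_n -> 'rV[R]_2) : Prop :=
  forall i, \sum_(j | j != i)
      (m i * m j / eucl_dist (q j) (q i) ^+ 3) *: (q j - q i) =
    - (multiplier m q * m i) *: (q i - center_of_mass m q).

Definition r0 (R : realType) (n : nat) (m : 'I_n -> R)
    (q : 'I_n -> 'rV[R]_2) : R :=
  (total_mass m / multiplier m q) `^ 3^-1.

Definition cocircular (R : realType) (n : nat) (q : 'I_n -> 'rV[R]_2) : Prop :=
  exists (o : 'rV[R]_2) (rho : R),
    0 < rho /\ forall i, eucl_dist (q i) o = rho.

(* q (s 0), ..., q (s n.-1) are met in this order when the circle through the
   bodies is traversed once counterclockwise starting from q (s 0). *)
Definition counterclockwise (R : realType) (n : nat) (q : 'I_n -> 'rV[R]_2)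
    (s : 'S_n) : Prop :=
  exists (o : 'rV[R]_2) (rho : R) (theta : 'I_n -> R),
    [/\ 0 < rho,
        forall k, q (s k) = o + rho *: unit_vec (theta k),
        forall k l : 'I_n, (k < l)%N -> theta k < theta l
      & forall k l : 'I_n, theta l < theta k + 2 * pi].

(* The indices in exterior_side and diagonal_edge are positions in the
   counterclockwise order, starting from 0; the edge they stand for joins the
   bodies at these positions. *)
Definition exterior_side (n : nat) (k l : 'I_n) : bool :=
  (`|k - l| == 1)%N || (`|k - l| == n - 1)%N.

Definition diagonal_edge (n : nat) (k l : 'I_n) : bool :=
  (k != l) && ~~ exterior_side k l.

(* Main.v *)
(* Put S_kl = 1 / r_kl^3 - 1 / r0^3.  Eliminating the center of mass turns the
   equation of the body k into sum_l m_l S_kl (q_l - q_k) = 0.  On a circle of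
   radius rho, the chord from k to l makes with the tangent at k an angle psi_l
   in (0, pi) and has length 2 rho sin psi_l.  All chords lie strictly on one
   side of the tangent, so S_kl changes sign and some chord is longer than r0.
   If the first chord after k had length at least r0, then S_kl would be
   nonpositive up to the angle pi - arcsin (r0 / 2 rho) and positive beyond it,
   and the sum could not vanish across the line in that direction.  Hence every
   exterior side is shorter than r0, and a chord longer than r0 is a diagonal. *)
Require Import Defs.
From HB Require Import structures.
From mathcomp Require Import all_boot all_order all_algebra all_fingroup.
From mathcomp Require Import all_classical all_reals all_analysis.
From mathcomp Require Import ring lra zify.
Set Implicit Arguments.
Unset Strict Implicit.
Unset Printing Implicit Defensive.
Import Order.TTheory GRing.Theory Num.Theory.
Local Open Scope ring_scope.

(** * Sign argument for weighted chords balanced at one vertex *)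

Section BalancedChords.
Variables (R : rcfType) (I : finType) (P : pred I) (s c a : I -> R) (t : R).
Hypothesis s_gt0 : forall l, P l -> 0 < s l.
Hypothesis sc1 : forall l, P l -> s l ^+ 2 + c l ^+ 2 = 1.
Hypothesis c_inj : {in P &, injective c}.
Hypothesis card_P : (2 < #|P|)%N.
Hypothesis sg_a : forall l, P l -> Num.sg (a l) = Num.sg (t - s l).
Hypothesis normal_balance : \sum_(l | P l) a l * s l * s l = 0.
Hypothesis tangent_balance : \sum_(l | P l) a l * s l * c l = 0.

(* If all [s l] were equal to [t], then [c l] would take at most two values. *)
Lemma exists_neq_sine : exists2 l, P l & s l != t.
Proof.
apply/exists_inP; apply: contraT; rewrite negb_exists_in => /forall_inP eq_t.
have st l : P l -> s l = t by move=> /eq_t; rewrite negbK => /eqP.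
move: card_P; rewrite ltnNge => /negP; case.
(* The two possible values of [c l] are opposite, so the test [0 <= c l] tells them apart and would
   inject [P] into [bool]. *)
rewrite -card_bool; apply: (@leq_card_in _ _ (fun l => 0 <= c l)).
move=> k l Pk Pl /= eq_sg; apply: c_inj => //.
have /eqP : c k ^+ 2 = c l ^+ 2.
  by have := sc1 Pk; have := sc1 Pl; rewrite !st //; lra.
rewrite eqf_sqr => /orP[/eqP // | /eqP ckl].
by move: eq_sg; rewrite ckl oppr_ge0; case: (ltrgt0P (c l)) => // ->; rewrite oppr0.
Qed.

Lemma weight_sign l : P l -> s l != t -> 0 < a l * (t - s l).
Proof.
move=> Pl st; rewrite -sgr_gt0 sgrM sg_a // -expr2 lt0r sqr_ge0 sqrf_eq0 sgr_eq0.
by rewrite subr_eq0 eq_sym st.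
Qed.

Lemma weight_eq0 l : P l -> s l = t -> a l = 0.
Proof. by move=> Pl st; apply/eqP; rewrite -sgr_eq0 sg_a // st subrr sgr0. Qed.

(** With no chord longer than [t], every weight would be nonnegative and some weight positive, so
    the terms [a l * s l * s l] could not sum to zero. *)
Lemma exists_long_chord : exists2 l, P l & t < s l.
Proof.
apply/exists_inP; apply: contraT; rewrite negb_exists_in => /forall_inP short.
have [k Pk kt] := exists_neq_sine.
have a_gt0 l : P l -> s l != t -> 0 < a l.
  move=> Pl lt; have := weight_sign Pl lt; rewrite pmulr_lgt0 // subr_gt0.
  by rewrite lt_neqAle lt leNgt short.
have ge0 l : P l -> 0 <= a l * s l * s l.
  move=> Pl; have [/(weight_eq0 Pl)->|lt] := eqVneq (s l) t.
    by rewrite !mul0r.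
  by rewrite !mulr_ge0 // ltW ?s_gt0 ?a_gt0.
have /eqP := psumr_eq0P ge0 normal_balance Pk.
by rewrite !mulf_eq0 !gt_eqF ?s_gt0 ?a_gt0.
Qed.

(* If [t <= s p], then the line through the vertex at the angle with sine [t]
   and cosine [- sqrt (1 - t ^+ 2)] separates the chords longer than [t] from
   the shorter ones, so all contributions to the balance across this line have
   the same sign. *)
Lemma first_chord_short p :
  0 < t -> P p -> (forall l, P l -> c l <= c p) -> s p < t.
Proof.
move=> t_gt0 Pp c_le; rewrite ltNge; apply/negP => t_le.
have [k Pk kt] := exists_neq_sine.
have t_le1 : t ^+ 2 <= 1 by have := sc1 Pp; have := sqr_ge0 (c p); nra.
pose w := Num.sqrt (1 - t ^+ 2).
have w_ge0 : 0 <= w by apply: sqrtr_ge0.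
have w2 : w ^+ 2 = 1 - t ^+ 2 by rewrite sqr_sqrtr // subr_ge0.
have cw l : P l -> c l <= w.
  move=> Pl; apply: le_trans (c_le _ Pl) _.
  by rewrite leNgt; apply/negP => ?; have := sc1 Pp; nra.
(* Write [s l = sin x], [c l = cos x], [t = sin b], [w = cos b]. The last factor is sin (x + b), and
   [cw] says b <= x. Long chords have x < pi - b, a negative weight and a positive factor; short
   ones have x > pi - b, and both signs swap. *)
have gt0 l : P l -> s l != t -> 0 < - (a l * s l * (s l * w + c l * t)).
  move=> Pl lt; have A := weight_sign Pl lt; have S := s_gt0 Pl.
  have E := sc1 Pl; have C := cw _ Pl.
  rewrite -mulrN -mulrA.
  have [ts|st] := ltP t (s l).
    have ? : a l < 0 by rewrite -(nmulr_lgt0 (x := t - s l)) // subr_lt0.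
    have ? : - w < c l by rewrite ltNge; apply/negP => ?; nra.
    rewrite nmulr_rgt0 // nmulr_llt0 //; nra.
  have {}st : s l < t by rewrite lt_neqAle lt.
  have ? : 0 < a l by rewrite -(pmulr_lgt0 (x := t - s l)) // subr_gt0.
  have ? : c l < - w by rewrite ltNge; apply/negP => ?; nra.
  rewrite pmulr_rgt0 // pmulr_rgt0 //; nra.
have ge0 l : P l -> 0 <= - (a l * s l * (s l * w + c l * t)).
  move=> Pl; have [/(weight_eq0 Pl)->|lt] := eqVneq (s l) t.
    by rewrite !mul0r oppr0.
  exact/ltW/gt0.
have sum0 : \sum_(l | P l) - (a l * s l * (s l * w + c l * t)) = 0.
  transitivity (- ((\sum_(l | P l) a l * s l * s l) * w
                 + (\sum_(l | P l) a l * s l * c l) * t)).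
    rewrite !mulr_suml -big_split -sumrN; apply: eq_bigr => l _ /=; ring.
  by rewrite normal_balance tangent_balance !mul0r addr0 oppr0.
by have := gt0 _ Pk kt; rewrite (psumr_eq0P ge0 sum0 Pk) ltxx.
Qed.

End BalancedChords.

(** * Euclidean distance and chords of the unit circle *)

Section PlaneGeometry.
Variable R : realType.
Implicit Types (t x : R) (v : 'rV[R]_2).

Lemma eucl_normN v : eucl_norm (- v) = eucl_norm v.
Proof.
by rewrite /eucl_norm; congr Num.sqrt; apply: eq_bigr => k _; rewrite mxE sqrrN.
Qed.

Lemma eucl_distC (p q : 'rV[R]_2) : eucl_dist p q = eucl_dist q p.
Proof. by rewrite /eucl_dist -opprB eucl_normN. Qed.

Lemma eucl_dist_gt0 (p q : 'rV[R]_2) : p != q -> 0 < eucl_dist p q.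
Proof.
move=> pq; rewrite sqrtr_gt0 lt0r sumr_ge0 ?andbT => [|k _]; last exact: sqr_ge0.
apply: contraNneq pq => sum0; rewrite -subr_eq0; apply/eqP/rowP => k.
have /eqP := psumr_eq0P (fun k _ => sqr_ge0 ((p - q) 0 k)) sum0 (i := k) isT.
by rewrite sqrf_eq0 => /eqP ->; rewrite mxE.
Qed.

Lemma eucl_norm_scale_unit_vec x t : eucl_norm (x *: unit_vec t) = `|x|.
Proof.
rewrite /eucl_norm big_ord_recl big_ord1 !mxE /= -sqrtr_sqr; congr Num.sqrt.
by rewrite !exprMn -mulrDr cos2Dsin2 mulr1.
Qed.

Lemma unit_vecD2pi t : unit_vec (t + 2 * pi) = unit_vec t.
Proof. by apply/rowP => k; rewrite !mxE mulr_natl cosD2pi sinD2pi. Qed.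

(** The endpoints lie symmetrically about the direction [t + x], so the chord is perpendicular to
    it. *)
Lemma unit_vec_chord t x :
  unit_vec (t + 2 * x) - unit_vec t = (2 * sin x) *: unit_vec (t + x + pi / 2).
Proof.
have -> : t + 2 * x = t + x + x by ring.
have {2}-> : t = t + x - x by ring.
move: (t + x) => y; apply/rowP => k; rewrite !mxE cosDpihalf sinDpihalf.
rewrite cosB sinB cosD sinD.
by case: ifP => _; ring.
Qed.

Lemma sg_invr_cubeB (x y : R) :
  0 < x -> 0 < y -> Num.sg ((x ^+ 3)^-1 - (y ^+ 3)^-1) = Num.sg (y - x).
Proof.
move=> x0 y0.
have -> : (x ^+ 3)^-1 - (y ^+ 3)^-1 =
    (y - x) * ((y ^+ 2 + y * x + x ^+ 2) / (x ^+ 3 * y ^+ 3)).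
  by field; rewrite !gt_eqF.
rewrite sgrM [X in _ * X]gtr0_sg ?mulr1 // divr_gt0 ?mulr_gt0 ?exprn_gt0 //.
by rewrite !addr_gt0 ?mulr_gt0 ?exprn_gt0.
Qed.

End PlaneGeometry.

(** * Positivity of [r0] and the pairwise form of the equations *)

Section CentralConfiguration.
Variables (R : realType) (n : nat) (m : 'I_n -> R) (q : 'I_n -> 'rV[R]_2).
Hypothesis n_gt1 : (1 < n)%N.
Hypothesis m_gt0 : forall i, 0 < m i.
Hypothesis q_inj : injective q.

Lemma total_mass_gt0 : 0 < total_mass m.
Proof.
rewrite /total_mass (bigD1 (Ordinal (ltnW n_gt1))) //= ltr_pwDl // sumr_ge0 //.
by move=> i _; apply/ltW.
Qed.

Lemma multiplier_gt0 : 0 < multiplier m q.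
Proof.
pose i0 := Ordinal (ltnW n_gt1); pose i1 := Ordinal n_gt1.
have dist_gt0 (i j : 'I_n) : (i < j)%N -> 0 < m i * m j / eucl_dist (q i) (q j).
  move=> ij; rewrite divr_gt0 ?mulr_gt0 ?eucl_dist_gt0 // (inj_eq q_inj).
  by rewrite neq_ltn ij.
rewrite divr_gt0 //.
  rewrite /potential (bigD1 i0) //= (bigD1 i1) //= -addrA ltr_pwDl ?dist_gt0 //.
  rewrite addr_ge0 ?sumr_ge0 // => [j /andP[] ij _|i _]; first exact/ltW/dist_gt0.
  by rewrite sumr_ge0 // => j ij; apply/ltW/dist_gt0.
have ge0 i : 0 <= m i * eucl_dist (q i) (center_of_mass m q) ^+ 2.
  by rewrite mulr_ge0 ?sqr_ge0 ?ltW.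
(* Zero inertia would put all bodies at the center of mass, yet the first two are distinct. *)
rewrite lt0r sumr_ge0 ?andbT //; apply/eqP => I0.
have at_center i : q i = center_of_mass m q.
  apply/eqP; apply: contraT => ne.
  have /eqP := psumr_eq0P (fun i _ => ge0 i) I0 (i := i) isT.
  by rewrite gt_eqF // mulr_gt0 // exprn_gt0 // eucl_dist_gt0.
by have /(congr1 val) := q_inj (etrans (at_center i0) (esym (at_center i1))).
Qed.

Lemma r0_gt0 : 0 < r0 m q.
Proof. by rewrite powR_gt0 // divr_gt0 ?total_mass_gt0 ?multiplier_gt0. Qed.

Lemma r0_cube : r0 m q ^+ 3 = total_mass m / multiplier m q.
Proof.
have x_gt0 : 0 < total_mass m / multiplier m q.
  by rewrite divr_gt0 ?total_mass_gt0 ?multiplier_gt0.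
by rewrite -powR_mulrn ?ltW ?r0_gt0 // /r0 -powRrM mulVf ?pnatr_eq0 // powRr1 // ltW.
Qed.

(** Turns the right-hand side of the central equation into differences [q j - q i], as on its
    left. *)
Lemma center_of_mass_shift i :
  total_mass m *: (q i - center_of_mass m q) =
  - \sum_(j | j != i) m j *: (q j - q i).
Proof.
have -> : \sum_(j | j != i) m j *: (q j - q i) = \sum_j m j *: (q j - q i).
  by rewrite [RHS](bigD1 i) //= subrr scaler0 add0r.
rewrite scalerBr /center_of_mass scalerA divff ?gt_eqF ?total_mass_gt0 // scale1r.
rewrite /total_mass scaler_suml -sumrB -sumrN; apply: eq_bigr => j _.
by rewrite scalerBr opprB.
Qed.

(* Eliminating the center of mass with [lambda = total_mass / r0 ^ 3] leaves
   only pair interactions, attractive exactly below the distance [r0]. *)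
Lemma central_pairwise i :
  central m q ->
  \sum_(j | j != i) (m j * ((eucl_dist (q j) (q i) ^+ 3)^-1 - (r0 m q ^+ 3)^-1))
    *: (q j - q i) = 0.
Proof.
move=> /(_ i) cent.
have M0 : total_mass m != 0 by rewrite gt_eqF ?total_mass_gt0.
have mi0 : m i != 0 by rewrite gt_eqF.
apply: (scalerI mi0); rewrite scaler0.
pose C := \sum_(j | j != i) m j *: (q j - q i).
have E : q i - center_of_mass m q = - ((total_mass m)^-1 *: C).
  apply: (scalerI M0); rewrite center_of_mass_shift scalerN scalerA.
  by rewrite divff // scale1r.
rewrite scaler_sumr.
transitivity (\sum_(j | j != i) (m i * m j / eucl_dist (q j) (q i) ^+ 3) *: (q j - q i)
   - (m i * (r0 m q ^+ 3)^-1) *: C).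
  rewrite /C scaler_sumr -sumrB; apply: eq_bigr => j _.
  by rewrite !scalerA -scalerBl; congr (_ *: _); ring.
rewrite cent E scalerN scaleNr opprK scalerA -scalerBl r0_cube invf_div.
by rewrite [X in X *: _](_ : _ = 0) ?scale0r //; ring.
Qed.

End CentralConfiguration.

(* The angle at position [k] between the tangent and the chord to [l], by the
   tangent-chord theorem half of the counterclockwise arc from [k] to [l]. *)
Definition half_arc (R : realType) (n : nat) (theta : 'I_n -> R) (k l : 'I_n) : R :=
  (theta l - theta k) / 2 + (if (k < l)%N then 0 else pi).

(** * Chords of the circle in terms of half arcs *)

Section CocircularConfiguration.
Variables (R : realType) (n : nat) (m : 'I_n -> R) (q : 'I_n -> 'rV[R]_2).
Variables (s : 'S_n) (o : 'rV[R]_2) (rho : R) (theta : 'I_n -> R).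
Hypothesis n_ge4 : (4 <= n)%N.
Hypothesis m_gt0 : forall i, 0 < m i.
Hypothesis q_inj : injective q.
Hypothesis q_central : central m q.
Hypothesis rho_gt0 : 0 < rho.
Hypothesis q_polar : forall k, q (s k) = o + rho *: unit_vec (theta k).
Hypothesis theta_lt : forall k l : 'I_n, (k < l)%N -> theta k < theta l.
Hypothesis theta_turn : forall k l : 'I_n, theta l < theta k + 2 * pi.

Let n_gt1 : (1 < n)%N := ltnW (ltnW n_ge4).
Let psi := half_arc theta.

Lemma half_arc_itv k l : l != k -> 0 < psi k l < pi.
Proof.
rewrite /psi /half_arc neq_ltn; have := theta_turn k l; have := theta_turn l k.
case: ltngtP => // kl lk kl' _; have := theta_lt kl; lra.
Qed.

Lemma half_arc_inj k : {in [pred l : 'I_n | l != k] &, injective (psi k)}.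
Proof.
move=> i j ik jk eq_psi; apply: val_inj; apply/eqP; rewrite /= eqn_leq.
rewrite [(i <= j)%N]leqNgt [(j <= i)%N]leqNgt.
suff lt_psi (x y : 'I_n) : psi k x = psi k y -> ~~ (x < y)%N by rewrite !lt_psi.
move=> {i j ik jk eq_psi} E; apply/negP => /theta_lt xy; move: E.
have := theta_turn x y; have := theta_turn y x; rewrite /psi /half_arc.
(* In equal branches the angles of [x] and [y] would agree; in different branches they would differ
   by a full turn. *)
by do 2 case: ifP => _; lra.
Qed.

Lemma unit_vec_half_arc k l : unit_vec (theta k + 2 * psi k l) = unit_vec (theta l).
Proof.
rewrite /psi /half_arc; case: ifP => _.
  by congr unit_vec; field.
by rewrite -(unit_vecD2pi (theta l)); congr unit_vec; field.
Qed.

Lemma chord_vec k l :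
  q (s l) - q (s k) =
  (2 * rho * sin (psi k l)) *: unit_vec (theta k + psi k l + pi / 2).
Proof.
rewrite !q_polar opprD addrACA subrr add0r -scalerBr -(unit_vec_half_arc k l).
by rewrite unit_vec_chord scalerA; congr (_ *: _); ring.
Qed.

Lemma chord_length k l : l != k ->
  eucl_dist (q (s l)) (q (s k)) = 2 * rho * sin (psi k l).
Proof.
move=> lk; rewrite /eucl_dist chord_vec eucl_norm_scale_unit_vec ger0_norm //.
by rewrite !mulr_ge0 ?ltW // sin_gt0_pi ?half_arc_itv.
Qed.

Let weight k l :=
  m (s l) * ((eucl_dist (q (s l)) (q (s k)) ^+ 3)^-1 - (r0 m q ^+ 3)^-1).

(** By [chord_length], a half arc with this sine has a chord of length [r0 m q]. *)
Let sine := r0 m q / (2 * rho).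

Lemma sine_gt0 : 0 < sine.
Proof. by rewrite divr_gt0 ?mulr_gt0 ?r0_gt0. Qed.

Lemma sg_weight k l : l != k ->
  Num.sg (weight k l) = Num.sg (sine - sin (psi k l)).
Proof.
move=> lk; have rho2 : 0 < 2 * rho by rewrite mulr_gt0.
rewrite /weight sgrM gtr0_sg // mul1r sg_invr_cubeB ?r0_gt0 //; last first.
  by rewrite eucl_dist_gt0 // (inj_eq q_inj) (inj_eq perm_inj).
have -> : r0 m q - eucl_dist (q (s l)) (q (s k)) =
    2 * rho * (sine - sin (psi k l)).
  by rewrite chord_length // /sine; field; rewrite gt_eqF.
by rewrite sgrM gtr0_sg // mul1r.
Qed.

(** Measured from the tangent at [k], the chord to [l] has direction [psi k l]; the sums are the
    inward normal and tangential components of the pairwise equation. *)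
Lemma balance k :
  \sum_(l | l != k) weight k l * sin (psi k l) * sin (psi k l) = 0 /\
  \sum_(l | l != k) weight k l * sin (psi k l) * cos (psi k l) = 0.
Proof.
have := central_pairwise n_gt1 m_gt0 q_inj (s k) q_central.
rewrite (reindex_inj (@perm_inj _ s)) /=.
rewrite (eq_bigl (fun l => l != k)) => [|l]; last by rewrite (inj_eq perm_inj).
rewrite (eq_bigr (fun l => (2 * rho) *: ((weight k l * sin (psi k l)) *:
  unit_vec (theta k + psi k l + pi / 2)))); last first.
  by move=> l _; rewrite chord_vec !scalerA; congr (_ *: _); rewrite /weight; ring.
rewrite -scaler_sumr => /eqP; rewrite scaler_eq0 gt_eqF ?mulr_gt0 //= => /eqP sum0.
pose F (f : R -> R) := \sum_(l | l != k) weight k l * sin (psi k l) * f (psi k l).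
have coord j : \sum_(l | l != k)
    weight k l * sin (psi k l) * unit_vec (theta k + psi k l + pi / 2) 0 j = 0.
  have := congr1 (fun v : 'rV[R]_2 => v 0 j) sum0; rewrite /= summxE mxE => sum0j.
  by rewrite -[RHS]sum0j; apply: eq_bigr => l _; rewrite [RHS]mxE.
have sum_sin : F (fun x => sin (theta k + x)) = 0.
  apply: oppr_inj; rewrite oppr0 -[RHS](coord 0) -sumrN.
  by apply: eq_bigr => l _; rewrite !mxE /= cosDpihalf mulrN.
have sum_cos : F (fun x => cos (theta k + x)) = 0.
  by rewrite -[RHS](coord 1); apply: eq_bigr => l _; rewrite !mxE /= sinDpihalf.
split.
  (* Rotating the two coordinate sums back by [theta k] leaves only the angle [psi k l]. *)
  transitivity (F (fun x => sin (theta k + x)) * cos (theta k)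
              - F (fun x => cos (theta k + x)) * sin (theta k)); last first.
    by rewrite sum_sin sum_cos !mul0r subr0.
  rewrite /F !mulr_suml -sumrB; apply: eq_bigr => l _.
  by rewrite -!mulrA -!mulrBr -sinB addrAC subrr add0r.
transitivity (F (fun x => cos (theta k + x)) * cos (theta k)
            + F (fun x => sin (theta k + x)) * sin (theta k)); last first.
  by rewrite sum_sin sum_cos !mul0r addr0.
rewrite /F !mulr_suml -big_split; apply: eq_bigr => l _ /=.
by rewrite -!mulrA -!mulrDr -cosB addrAC subrr add0r.
Qed.

Lemma sin_half_arc_gt0 k l : l != k -> 0 < sin (psi k l).
Proof. by move=> lk; rewrite sin_gt0_pi ?half_arc_itv. Qed.

Lemma sin2_cos2_half_arc k l :
  l != k -> sin (psi k l) ^+ 2 + cos (psi k l) ^+ 2 = 1.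
Proof. by rewrite addrC cos2Dsin2. Qed.

Lemma half_arc_itvcc k l : l != k -> psi k l \in `[0, pi].
Proof. by move=> /half_arc_itv /andP[? ?]; rewrite in_itv /= !ltW. Qed.

Lemma cos_half_arc_inj k : {in [pred l : 'I_n | l != k] &, injective (cos \o psi k)}.
Proof.
move=> i j ik jk /(cos_inj (half_arc_itvcc ik) (half_arc_itvcc jk)).
exact: half_arc_inj.
Qed.

(** Four bodies already give three chords at each vertex, as [card_P] requires. *)
Lemma card_others k : (2 < #|[pred l : 'I_n | l != k]|)%N.
Proof. by rewrite (cardC1 k) card_ord; lia. Qed.

Lemma exists_long_edge k : exists2 l, l != k & r0 m q < eucl_dist (q (s l)) (q (s k)).
Proof.
have [normal _] := balance k.
have [l lk] := exists_long_chord (sin_half_arc_gt0 (k := k))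
  (sin2_cos2_half_arc (k := k)) (cos_half_arc_inj (k := k)) (card_others k)
  (sg_weight (k := k)) normal.
by rewrite ltr_pdivrMr ?mulr_gt0 // mulrC => ?; exists l; rewrite ?chord_length.
Qed.

Lemma first_edge_short k p :
  p != k -> (forall l, l != k -> psi k p <= psi k l) ->
  eucl_dist (q (s p)) (q (s k)) < r0 m q.
Proof.
move=> pk p_first; have [normal tangent] := balance k.
have := first_chord_short (sin_half_arc_gt0 (k := k))
  (sin2_cos2_half_arc (k := k)) (cos_half_arc_inj (k := k)) (card_others k)
  (sg_weight (k := k)) normal tangent sine_gt0 pk.
rewrite ltr_pdivlMr ?mulr_gt0 // mulrC chord_length //; apply => l lk /=.
(* Cosine decreases on [0, pi], so the smallest half arc has the largest cosine. *)
by rewrite leNgt ltr_cos ?half_arc_itvcc // -leNgt p_first.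
Qed.

(** Every exterior side is the first chord counterclockwise from one of its ends: from the earlier
    position if they are adjacent, from the last one if the side closes the polygon. *)
Lemma exterior_side_short k l :
  exterior_side k l -> eucl_dist (q (s k)) (q (s l)) < r0 m q.
Proof.
wlog kl : k l / (k < l)%N => [hwlog ext|].
  case: (ltngtP k l) => [kl|lk|/val_inj kl].
  - exact: hwlog.
  - by rewrite eucl_distC hwlog // /exterior_side distnC.
  - by exfalso; move: ext; rewrite kl /exterior_side distnn; lia.
rewrite /exterior_side distnEr ?(ltnW kl) // => /orP[/eqP next|/eqP wrap].
  rewrite eucl_distC; apply: first_edge_short => [|i ik].
    by rewrite neq_ltn kl orbT.
  have [->//|il] := eqVneq i l.
  rewrite /psi /half_arc kl; case: ifP => [ki|_].
    have /theta_lt : (l < i)%N.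
      by rewrite ltn_neqAle eq_sym il; move: ki; rewrite -(subnK kl); lia.
    by lra.
  by have := theta_turn i l; lra.
(* All half arcs from the last position carry the same summand [pi], so they are ordered as [theta]
   and position 0 comes first. *)
have k0 : (k = 0 :> nat)%N by have := ltn_ord l; lia.
have l_max : (l = n.-1 :> nat)%N by have := ltn_ord l; lia.
apply: first_edge_short => [|i il]; first by rewrite neq_ltn kl.
rewrite /psi /half_arc ltnNge (ltnW kl) /= ltnNge l_max.
rewrite -ltnS prednK ?ltn_ord /= ?(leq_trans _ n_ge4) // lerD2r ler_pM2r ?invr_gt0 //.
rewrite lerD2r; have [->//|ik] := eqVneq i k.
by apply/ltW/theta_lt; rewrite k0 lt0n -k0.
Qed.

End CocircularConfiguration.

Theorem theorem5 (R : realType) (n : nat) (m : 'I_n -> R)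
    (q : 'I_n -> 'rV[R]_2) (s : 'S_n) (hn : (4 <= n)%N)
    (m_gt0 : forall i, 0 < m i) (q_inj : injective q)
    (q_central : central m q) (q_cocircular : cocircular q)
    (s_ccw : counterclockwise q s) :
  (forall k l : 'I_n, exterior_side k l ->
     eucl_dist (q (s k)) (q (s l)) < r0 m q) /\
  (forall k : 'I_n, exists2 l : 'I_n, diagonal_edge k l &
     r0 m q < eucl_dist (q (s k)) (q (s l))).
Proof.
have [center [rho [theta [rho_gt0 q_polar theta_lt theta_turn]]]] := s_ccw.
have short := exterior_side_short hn m_gt0 q_inj q_central rho_gt0 q_polar
  theta_lt theta_turn.
split=> // k.
have [l lk long] := exists_long_edge hn m_gt0 q_inj q_central rho_gt0 q_polar
  theta_lt theta_turn k.
exists l; last by rewrite eucl_distC.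
rewrite /diagonal_edge eq_sym lk /=; apply/negP => /short.
by rewrite eucl_distC ltNge ltW.
Qed.
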